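(* Let $n\geq 4$ and let $V'\subseteq V(Q_n)$, where $Q_n$ is the $n$-dimensional cube. If $|V'|\geq 2^{n-1}+1$, then at least one of the following two conditions holds: (a) there are four vertices in $V'$ whose induced subgraph in $Q_n$ is a claw $K_{1,3}$; (b) there are eight vertices in $V'$ whose induced subgraph in $Q_n$ is a simple cycle (of length eight).
   Context: $Q_n$ denotes the $n$-dimensional hypercube graph: its vertex set is $\{0,1\}^n$, and two vertices are adjacent iff they differ in exactly one coordinate. A claw is the complete bipartite graph $K_{1,3}$. A set $S$ of vertices induces a graph $H$ if the subgraph of $Q_n$ with vertex set $S$ and all edges of $Q_n$ between vertices of $S$ is isomorphic to $H$. *)

(* Defs.v *)
From mathcomp Require Import all_boot.

Set Implicit Arguments.
Unset Strict Implicit.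
Unset Printing Implicit Defensive.

Notation cube n := {ffun 'I_n -> bool}.

Definition cube_adj (n : nat) : rel (cube n) :=
  [rel x y : cube n | #|[set i | x i != y i]| == 1].

Definition complete_bipartite (m n : nat) : rel ('I_m + 'I_n) :=
  [rel u v : 'I_m + 'I_n | match u, v with
             | inl _, inr _ | inr _, inl _ => true
             | _, _ => false
             end].

Definition claw : rel ('I_1 + 'I_3) := @complete_bipartite 1 3.

(* [ordS] is the successor modulo [k]. This is the simple cycle of length [k]
   only for [3 <= k]. *)
Definition cycle_graph (k : nat) : rel 'I_k :=
  [rel i j : 'I_k | (j == ordS i) || (i == ordS j)].

Definition induced (T : finType) (e : rel T) (S : {set T}) :
  rel {x : T | x \in S} := [rel x y : {x : T | x \in S} | e (val x) (val y)].

Definition graph_isomorphic (T U : finType) (e : rel T) (h : rel U) : Prop :=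
  exists f : T -> U, bijective f /\ forall x y, h (f x) (f y) = e x y.

Definition induces (T : finType) (e : rel T) (S : {set T})
    (U : finType) (h : rel U) : Prop :=
  graph_isomorphic (@induced T e S) h.

(* Main.v *)
(** Halving the cube repeatedly along one coordinate, and keeping the half in
    which [V] is denser, leaves a copy of [Q_4] with at least [9] points of [V].
    In [Q_4], no set of at most [7] vertices meets all the claws and all the
    images of one suitable induced octagon under the automorphisms of [Q_4];
    this is checked by a branching search. So one of these subgraphs avoids
    the complement of [V]. *)

Require Import Defs.
From mathcomp Require Import all_boot.

Set Implicit Arguments.
Unset Strict Implicit.
Unset Printing Implicit Defensive.

(** An injection out of the pattern, rather than a subset of the host, composes directly with
    embeddings of cubes. *)
Definition has_copy (T : finType) (e : rel T) (V : {set T})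
    (U : finType) (h : rel U) : Prop :=
  exists g : U -> T,
    [/\ injective g, forall u, g u \in V & forall u v, e (g u) (g v) = h u v].

Lemma has_copy_induces (T U : finType) (e : rel T) (h : rel U) (V : {set T}) :
  has_copy e V h ->
  exists S : {set T}, [/\ S \subset V, #|S| = #|U| & induces e S h].
Proof.
move=> [g [g_inj gV ge]].
have cardS : #|g @: [set: U]| = #|U| by rewrite card_imset // cardsT.
exists (g @: setT); split=> //; first by apply/subsetP=> _ /imsetP[u _ ->].
pose k u : {x | x \in g @: setT} := exist _ (g u) (imset_f g (in_setT u)).
have k_inj : injective k by move=> u v /(congr1 val) /g_inj.
(* Equal cardinalities make the injection [k] bijective; its inverse [f] is the isomorphism onto the
   pattern. *)
have [|f kK fK] := inj_card_bij k_inj; first by rewrite card_sig -cardS.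
exists f; split; first by exists k.
by move=> x y; rewrite -ge -{2}(fK x) -{2}(fK y).
Qed.

Lemma has_copy_embed (T T' U : finType) (e : rel T) (e' : rel T') (h : rel U)
    (f : T -> T') (V : {set T'}) :
  injective f -> (forall x y, e' (f x) (f y) = e x y) ->
  has_copy e (f @^-1: V) h -> has_copy e' V h.
Proof.
move=> f_inj fe [g [g_inj gV ge]]; exists (f \o g); split=> [|u|u v] /=.
- exact: inj_comp.
- by have := gV u; rewrite inE.
- by rewrite fe ge.
Qed.

Definition cube_cons n (b : bool) (x : cube n) : cube n.+1 :=
  [ffun i => oapp x b (unlift ord0 i)].

Lemma cube_cons0 n b (x : cube n) : cube_cons b x ord0 = b.
Proof. by rewrite ffunE unlift_none. Qed.

Lemma cube_consS n b (x : cube n) i : cube_cons b x (lift ord0 i) = x i.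
Proof. by rewrite ffunE liftK. Qed.

Lemma cube_cons_inj n b : injective (@cube_cons n b).
Proof.
by move=> x y /ffunP eq_xy; apply/ffunP=> i; have := eq_xy (lift ord0 i);
   rewrite !cube_consS.
Qed.

Lemma cube_cons_adj n b (x y : cube n) :
  cube_adj (cube_cons b x) (cube_cons b y) = cube_adj x y.
Proof.
rewrite /cube_adj /= -!sum1dep_card big_mkcond big_ord_recl !cube_cons0 eqxx.
rewrite [in RHS]big_mkcond; congr (_ == 1).
by apply: eq_bigr => i _; rewrite !cube_consS.
Qed.

Lemma cube_consP n (x : cube n.+1) : exists b y, x = cube_cons b y.
Proof.
exists (x ord0), [ffun i => x (lift ord0 i)]; apply/ffunP=> i.
by case: (unliftP ord0 i) => [j|] ->; rewrite ?cube_consS ?cube_cons0 ?ffunE.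
Qed.

Lemma card_cube_halves n (V : {set cube n.+1}) :
  #|V| <= #|cube_cons true @^-1: V| + #|cube_cons false @^-1: V|.
Proof.
pose half b := cube_cons b @: (cube_cons b @^-1: V).
rewrite -(card_imset _ (@cube_cons_inj n true)).
rewrite -(card_imset _ (@cube_cons_inj n false)).
apply: leq_trans (leq_card_setU (half true) (half false)).
apply: subset_leq_card; apply/subsetP=> x xV.
have [b [y def_x]] := cube_consP x.
have : x \in half b by rewrite def_x imset_f // inE -def_x.
by rewrite inE; case: b {def_x} => ->; rewrite ?orbT.
Qed.

Section HittingSets.

Variable T : eqType.
Implicit Types (C p : seq T) (F : seq (seq T)).

(** The bounded search tree for hitting sets: branch over the vertex that hits the first member,
    then drop every member it hits. *)
Fixpoint hittable d F : bool :=
  if F isn't p :: _ then true else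
  if d isn't d'.+1 then false else
  has (fun v => hittable d' [seq q <- F | v \notin q]) p.

(** The set [C] steers the search: branch on a point [v] of [C] in the first member. The surviving
    members avoid [v], so [C] without [v] still hits them. *)
Lemma hittableP C d F :
  {in F, forall p, has (mem C) p} -> size C <= d -> hittable d F.
Proof.
elim: d F C => [|d IHd] [//|p F] C hitC sizeC.
  have /hasP[v _ /=] := hitC p (mem_head p F).
  by move: sizeC; rewrite leqn0 => /nilP ->.
have /hasP[v vp vC] := hitC p (mem_head p F).
apply/hasP; exists v => //; apply: (IHd _ (rem v C)).
  move=> q; rewrite mem_filter => /andP[v'q /hitC /hasP[w wq wC]].
  apply/hasP; exists w => //=; move: wC; rewrite /= (perm_mem (perm_to_rem vC)).
  by rewrite inE => /predU1P[def_w|//]; rewrite -def_w wq in v'q.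
by rewrite size_rem // -ltnS (leq_trans _ sizeC) // ltn_predL; case: (C) vC.
Qed.

End HittingSets.

(* Vertices of [Q_4] are coded by lists of four bits, so that the search
   computes. *)
Definition vertices4 : seq bitseq :=
  iter 4 (fun l => map (cons false) l ++ map (cons true) l) [:: [::]].

Definition flip (s : bitseq) (i : nat) : bitseq :=
  set_nth false s i (~~ nth false s i).

(** A centre [s] has four neighbours, so a claw at [s] omits one direction [i]. The centre comes
    first, as vertex [0] of [claw_nat]. *)
Definition claws4 : seq (seq bitseq) :=
  [seq s :: map (flip s) (rem i (iota 0 4)) | s <- vertices4, i <- iota 0 4].

(* The word lists the directions of the successive edges of an induced
   octagon; of the three orbits of induced octagons of [Q_4], only this one
   suffices on its own. *)
Definition octagons4 : seq (seq bitseq) :=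
  [seq scanl flip s (map (nth 0 p) [:: 0; 1; 2; 0; 3; 2; 1; 3])
     | p <- permutations (iota 0 4), s <- vertices4].

Lemma claws4_octagons4_unhittable : hittable 7 (claws4 ++ octagons4) = false.
Proof. by vm_compute. Qed.

Definition bits_adj (s t : bitseq) : bool :=
  count (fun i => nth false s i != nth false t i) (iota 0 4) == 1.

(** Position [i] of the list plays vertex [i] of a pattern on [nat], which turns the check into a
    boolean computation. *)
Definition is_copy (k : nat) (h : rel nat) (p : seq bitseq) : bool :=
  [&& size p == k, uniq p, all [in vertices4] p &
      all (fun i => all (fun j =>
        bits_adj (nth [::] p i) (nth [::] p j) == h i j) (iota 0 k)) (iota 0 k)].

Definition claw_nat : rel nat := [rel i j | (i == 0) != (j == 0)].

Definition cycle_nat k : rel nat :=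
  [rel i j | (j == i.+1 %% k) || (i == j.+1 %% k)].

Lemma claws4_copies : all (is_copy 4 claw_nat) claws4.
Proof. by vm_compute. Qed.

Lemma octagons4_copies : all (is_copy 8 (cycle_nat 8)) octagons4.
Proof. by vm_compute. Qed.

Definition vertex4 (s : bitseq) : cube 4 := [ffun i : 'I_4 => nth false s i].

Lemma vertex4_inj : {in vertices4 &, injective vertex4}.
Proof.
have size4 s : s \in vertices4 -> size s = 4.
  by move=> s_in; apply/eqP; move: s s_in; apply/allP.
move=> s t /size4 size_s /size4 size_t /ffunP eq_st.
apply: (@eq_from_nth _ false) => [|i]; first by rewrite size_s.
by rewrite size_s => lti4; have := eq_st (Ordinal lti4); rewrite !ffunE.
Qed.

Lemma vertex4_adj s t : cube_adj (vertex4 s) (vertex4 t) = bits_adj s t.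
Proof.
rewrite /bits_adj -(val_enum_ord 4) count_map -size_filter /cube_adj /=.
rewrite cardsE cardE; congr (size _ == 1); rewrite -filter_predI.
by apply: eq_filter => i; rewrite /= andbT unfold_in !ffunE.
Qed.

(** The numbering [f] of the pattern's vertices carries a computed check over to the finite graph
    [h]. *)
Lemma has_copy_is_copy (U : finType) (h : rel U) k (hn : rel nat)
    (f : U -> nat) (p : seq bitseq) (V : {set cube 4}) :
  injective f -> (forall u, f u < k) -> (forall u v, hn (f u) (f v) = h u v) ->
  is_copy k hn p -> {in p, forall s, vertex4 s \in V} ->
  has_copy (@cube_adj 4) V h.
Proof.
move=> f_inj f_lt fh /and4P[/eqP sz_p uniq_p /allP p4 /allP adj_p] pV.
have f_in u : nth [::] p (f u) \in p by rewrite mem_nth ?sz_p.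
have f_iota u : f u \in iota 0 k by rewrite mem_iota f_lt.
exists (fun u => vertex4 (nth [::] p (f u))); split=> [u v||u v].
- move/(vertex4_inj (p4 _ (f_in u)) (p4 _ (f_in v)))/eqP.
  by rewrite nth_uniq ?sz_p // => /eqP /f_inj.
- by move=> u; apply: pV.
- have /allP adj_pu := adj_p _ (f_iota u).
  by rewrite vertex4_adj (eqP (adj_pu _ (f_iota v))).
Qed.

Lemma cube4_claw_or_octagon (V : {set cube 4}) :
  8 < #|V| ->
  has_copy (@cube_adj 4) V claw \/ has_copy (@cube_adj 4) V (@cycle_graph 8).
Proof.
move=> cardV.
pose inV s := vertex4 s \in V.
have [/hasP[p p_in /allP pV]|no_claw] := boolP (has (all inV) claws4).
  left; pose f (u : 'I_1 + 'I_3) := if u is inr i then i.+1 else 0.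
  apply: (has_copy_is_copy (f := f)) (allP claws4_copies p p_in) pV.
  - by move=> [i|i] [j|j] //=; rewrite ?(ord1 i) ?(ord1 j) // => -[] /val_inj ->.
  - by case=> [i|i] //=; rewrite ltnS.
  - by move=> [i|i] [j|j].
have [/hasP[p p_in /allP pV]|no_octagon] := boolP (has (all inV) octagons4).
  right; apply: (has_copy_is_copy (f := @nat_of_ord 8)) (allP octagons4_copies p p_in) pV.
  - exact: val_inj.
  - exact: ltn_ord.
  (* [ordS i] has value [i.+1 %% 8], so the two cycle relations agree by conversion. *)
  - by [].
suff : hittable 7 (claws4 ++ octagons4) by rewrite claws4_octagons4_unhittable.
(* With no listed claw or octagon inside [V], the codes of the complement of [V] hit them all. *)
pose C := [seq s <- vertices4 | ~~ inV s].
apply: (@hittableP _ C).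
  have in4 p : p \in claws4 ++ octagons4 -> {subset p <= vertices4}.
    rewrite mem_cat => /orP[/(allP claws4_copies)|/(allP octagons4_copies)];
    by case/and4P=> _ _ /allP.
  move=> p p_in; have : ~~ all inV p.
    move: p_in; rewrite mem_cat.
    by case/orP; [move: p; apply/hasPn | move: p; apply/hasPn].
  rewrite -has_predC => /hasP[s sp s'V]; apply/hasP; exists s => //.
  by rewrite inE mem_filter (in4 p) // andbT.
have uniqC : uniq (map vertex4 C).
  rewrite map_inj_in_uniq ?filter_uniq // => s t.
  by rewrite !mem_filter => /andP[_ s4] /andP[_ t4]; apply: vertex4_inj.
have sizeC : size C <= #|~: V|.
  rewrite -(size_map vertex4) -(card_uniqP uniqC).
  apply: subset_leq_card; apply/subsetP=> _ /mapP[s + ->].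
  by rewrite mem_filter in_setC => /andP[].
have := cardsC V; rewrite card_ffun card_bool card_ord => cardVC.
(* At least [9] of the [16] vertices lie in [V], which leaves at most [7] for [C]: the depth of the
   failed search. *)
by rewrite (leq_trans sizeC) // -(leq_add2l 9) -[9 + 7]cardVC leq_add2r.
Qed.

Lemma cube_claw_or_octagon n (V : {set cube n.+4}) :
  2 ^ n.+3 < #|V| ->
  has_copy (@cube_adj n.+4) V claw \/
  has_copy (@cube_adj n.+4) V (@cycle_graph 8).
Proof.
elim: n V => [|n IHn] V cardV; first exact: cube4_claw_or_octagon.
have [b half_b] : exists b, 2 ^ n.+3 < #|cube_cons b @^-1: V|.
  have [|le_t] := ltnP (2 ^ n.+3) #|cube_cons true @^-1: V|; first by exists true.
  have [|le_f] := ltnP (2 ^ n.+3) #|cube_cons false @^-1: V|; first by exists false.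
  (* If neither half exceeded [2 ^ n.+3], then [V] would have at most [2 ^ n.+4] points, against the
     strict bound. *)
  have := leq_trans cardV (leq_trans (card_cube_halves V) (leq_add le_t le_f)).
  by rewrite addnn -mul2n -expnS ltnn.
by case: (IHn _ half_b) => copy; [left | right];
  apply: has_copy_embed copy; [exact: cube_cons_inj | exact: cube_cons_adj
                             | exact: cube_cons_inj | exact: cube_cons_adj].
Qed.

Theorem theorem1 (n : nat) (n_ge4 : 4 <= n) (V : {set cube n})
    (cardV : 2 ^ (n - 1) + 1 <= #|V|) :
  (exists S : {set cube n},
     [/\ S \subset V, #|S| = 4 & induces (@cube_adj n) S claw]) \/
  (exists S : {set cube n},
     [/\ S \subset V, #|S| = 8 & induces (@cube_adj n) S (@cycle_graph 8)]).
Proof.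
case: n n_ge4 V cardV => [|[|[|[|n]]]] // _ V; rewrite addn1 subn1 => cardV.
have [] := cube_claw_or_octagon cardV => /has_copy_induces.
  by rewrite card_sum !card_ord; left.
by rewrite card_ord; right.
Qed.
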